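(* Let $n\ge2$ and let $X_{\cdot,B}$ be a simple (undirected, loopless) quantum graph on $M_n$, i.e. $B\in M_n$ is a real symmetric projector with $B\mathbf 1=0$. Then $\alpha(X_{\cdot,B})\le n-\operatorname{rk}B$.
   Context: $M_n=M_n(\mathbb C)$; ''projector'' means orthogonal projector; $\mathbf 1\in\mathbb C^n$ is the all-ones vector. $X_{\cdot,B}$ is the quantum graph on $M_n$ with adjacency operator the Schur multiplier $x\mapsto (B_{ij}x_{ij})_{i,j}$; its operator space is $S=\{\operatorname{diag}(v): v\in\operatorname{img}B\}\subseteq M_n$. A $k$-independent set of a quantum graph with operator space $S$ is a projector $P\in M_n$ of rank $k$ with $PSP\subseteq\mathbb CP$; the independence number $\alpha$ is the largest $k$ for which a $k$-independent set exists. *)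

(* Defs.v *)
From HB Require Import structures.
From mathcomp Require Import all_boot all_order all_algebra.
From mathcomp Require Import boolp classical_sets reals.
From mathcomp Require Export complex.

Set Implicit Arguments.
Unset Strict Implicit.
Unset Printing Implicit Defensive.
Import Order.TTheory GRing.Theory Num.Theory.

Local Open Scope ring_scope.
Local Open Scope sesquilinear_scope.
Local Open Scope classical_set_scope.

Definition orthogonal_projector (R : realType) (n : nat) (P : 'M[R[i]]_n) :=
  P *m P = P /\ P ^t* = P.

Definition matrix_image (R : realType) (n : nat) (B : 'M[R[i]]_n) :
    set 'cV[R[i]]_n :=
  range (fun w : 'cV[R[i]]_n => B *m w).

(* The operator space of the quantum graph whose adjacency operator is the
   Schur multiplier x |-> (B i j * x i j)_(i, j); the transpose is there only
   because [diag_mx] takes a row vector. *)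
Definition schur_operator_space (R : realType) (n : nat) (B : 'M[R[i]]_n) :
    set 'M[R[i]]_n :=
  [set diag_mx v^T | v in matrix_image B].

Definition independent_set (R : realType) (n : nat) (S : set 'M[R[i]]_n)
    (k : nat) (P : 'M[R[i]]_n) :=
  [/\ orthogonal_projector P, \rank P = k &
      [set P *m X *m P | X in S] `<=` range (fun c : R[i] => c *: P)].

(* Ranks are at most n, so the range k <= n loses nothing; that this maximum is
   the largest size of an independent set is [independence_numberP]. *)
Definition independence_number (R : realType) (n : nat)
    (S : set 'M[R[i]]_n) : nat :=
  \max_(k < n.+1 | `[< exists P, independent_set S k P >]) k.

Lemma independence_numberP (R : realType) (n : nat) (S : set 'M[R[i]]_n) :
  (exists P, independent_set S (independence_number S) P) /\
  (forall k P, independent_set S k P -> (k <= independence_number S)%N).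
Proof.
split; last first.
  move=> k P kP; have kn : (k < n.+1)%N.
    by case: kP => _ <- _; rewrite ltnS rank_leq_row.
  apply: (leq_bigmax_cond (Ordinal kn)).
  by apply/asboolP; exists P.
set p := fun k : 'I_n.+1 => `[< exists P, independent_set S k P >].
have p0 : p ord0.
  apply/asboolP; exists 0; split; last 1 first.
  - by move=> _ [X _ <-]; exists 0 => //; rewrite mulmx0 scaler0.
  - by split; [rewrite mulmx0 | apply/matrixP => i j; rewrite !mxE conjC0].
  - by rewrite mxrank0.
have p_gt0 : (0 < #|p|)%N by apply/card_gt0P; exists ord0.
have [k /asboolP kP kE] := eq_bigmax_cond (@nat_of_ord n.+1) p_gt0.
by rewrite (_ : independence_number S = k).
Qed.

(* Main.v *)
Require Import Defs.
From mathcomp Require Import all_boot all_order all_algebra.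
From mathcomp Require Import reals.

Set Implicit Arguments.
Unset Strict Implicit.
Import Order.TTheory GRing.Theory Num.Theory.
Local Open Scope ring_scope.
Local Open Scope sesquilinear_scope.

(* Let P be an independent set of rank k and write P diag(v) P = c(v) P for v in
   the image of B. As 1 is orthogonal to the image of B, the vectors v - c(v) 1
   form a space of dimension rk B, and all of them satisfy P diag(w) P = 0.
   Choose k linearly independent rows of P. The compression P diag(w) P is the
   sum of the w_i p_i^* p_i, where p_i is the i-th row of P, so it is injective
   on the k-dimensional space of vectors supported on the chosen indices. The
   two spaces meet trivially, whence rk B + k <= n. *)

(** The row [x *m F] is [x] placed at the indices [f]; entries at repeated indices add up on both
    sides. *)
Lemma diag_mx_mul_rowsub1 (K : comNzRingType) (m n : nat) (f : 'I_m -> 'I_n)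
    (x : 'rV[K]_m) :
  let F := rowsub f (1%:M : 'M[K]_n) in
  diag_mx (x *m F) = F^T *m diag_mx x *m F.
Proof.
move=> F; apply/matrixP => i j; rewrite mul_mx_diag !mxE -sumrMnl.
apply: eq_bigr => l _; rewrite !mxE.
have [->|fl] := eqVneq (f l) i; last by rewrite mulr0 mul0rn !mul0r.
by rewrite mulr1 mul1r mulr_natr.
Qed.

Lemma compress_diag_inj (R : realType) (n k : nat) (P : 'M[R[i]]_n)
    (f : 'I_k -> 'I_n) (x : 'rV[R[i]]_k) :
  P ^t* = P -> row_free (rowsub f P) ->
  P *m diag_mx (x *m rowsub f 1%:M) *m P = 0 -> x = 0.
Proof.
move=> Pherm; rewrite (rowsubE f P); set F := rowsub f 1%:M; move=> FPfree.
(* Grouped as [(P *m F^T *m diag_mx x) *m (F *m P)], the row-free right factor cancels. The adjoint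
   then turns [P *m F^T] into a right factor [F *m P], which cancels too. *)
rewrite diag_mx_mul_rowsub1 -/F -!mulmxA 2!mulmxA => /eqP.
rewrite mulmx_free_eq0 // => /eqP /(congr1 (fun M => M ^t*)).
rewrite !trmx_mul trmxK !map_mxM Pherm /= map_mxsub map_mx1 -/F => /eqP.
rewrite trmx0 map_mx0 mulmx_free_eq0 // map_mx_eq0 trmx_eq0 => /eqP diag0.
by apply/rowP => j; move/matrixP/(_ j j): diag0; rewrite !mxE eqxx.
Qed.

Lemma independent_set_leq (R : realType) (n k : nat) (B P : 'M[R[i]]_n) :
  B *m B = B -> B^T = B -> B *m (const_mx 1 : 'cV[R[i]]_n) = 0 ->
  independent_set (schur_operator_space B) k P -> (k + \rank B <= n)%N.
Proof.
move=> BB Bsym B1 [[PP Pherm] <- PSP].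
have /fin_all_exists [c cE] (i : 'I_n) :
    exists c : R[i], P *m diag_mx (row i B) *m P = c *: P.
  have [|c _ <-] := PSP (P *m diag_mx (row i B) *m P); last by exists c.
  exists (diag_mx (row i B)) => //; exists (col i B).
    by exists (delta_mx i 0) => //; rewrite colE.
  by rewrite tr_col Bsym.
(* The row space of [W] is the space of all v - c(v) 1. *)
pose W : 'M[R[i]]_n := B - \col_i c i *m const_mx 1.
have PWP (w : 'rV_n) : (w <= W)%MS -> P *m diag_mx w *m P = 0.
  case/submxP => u ->; rewrite mulmx_sum_row linear_sum mulmx_sumr mulmx_suml.
  apply: big1 => i _; rewrite linearZ /= -scalemxAr -scalemxAl.
  suff -> : P *m diag_mx (row i W) *m P = 0 by rewrite scaler0.
  have -> : row i W = row i B - c i *: const_mx 1.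
    by apply/rowP => j; rewrite !mxE big_ord1 !mxE.
  rewrite linearB linearZ /= diag_const_mx mulmxBr mulmxBl cE.
  by rewrite -scalemxAr mulmx1 -scalemxAl PP subrr.
have rankB : (\rank B <= \rank W)%N.
  (* The all-ones row times [B] is the transpose of [B] times the all-ones column, hence zero. *)
  suff <- : W *m B = B by apply: mxrankM_maxl.
  rewrite mulmxBl BB -mulmxA -[in const_mx 1 *m B]Bsym -trmx_const -trmx_mul.
  by rewrite B1 trmx0 mulmx0 subr0.
pose F := rowsub (maxrankfun P) (1%:M : 'M[R[i]]_n).
(* [F *m P] consists of the chosen independent rows of [P]. *)
have rankF : (\rank P <= \rank F)%N.
  apply: leq_trans (mxrankM_maxl F P).
  by rewrite -rowsubE (eqP (maxrowsub_free P)).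
rewrite (leq_trans _ (rank_leq_col (F + W)%MS)) // mxrank_disjoint_sum.
  exact: leq_add.
apply/eqP; rewrite -submx0; apply/rV_subP => w.
rewrite sub_capmx => /andP[/submxP[x ->] /PWP].
by move/(compress_diag_inj Pherm (maxrowsub_free P)) => ->; rewrite mul0mx sub0mx.
Qed.

Theorem proposition4p33 (R : realType) (n : nat) (B : 'M[R[i]]_n)
    (n_ge2 : (2 <= n)%N)
    (B_projector : orthogonal_projector B)
    (B_real : B \is a realmx)
    (B_symmetric : B^T = B)
    (B_loopless : B *m (const_mx 1 : 'cV[R[i]]_n) = 0) :
  (independence_number (schur_operator_space B) <= n - \rank B)%N.
Proof.
have [[P Pindep] _] := independence_numberP (schur_operator_space B).
rewrite leq_subRL ?rank_leq_row // addnC.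
by case: B_projector => BB _; apply: independent_set_leq Pindep.
Qed.
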